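(* Let $k\ge 1$ and let $S_1,\dots,S_k\subset\mathbb{C}$ be pairwise disjoint bounded convex sets with $\operatorname{diam}(S_i)\le 1$ for all $i$ and $\operatorname{dist}(S_i,S_j)\ge 5k$ for all $i\ne j$. For each $n\ge 1$ let $P_n(z)=\prod_{j=1}^{k}\prod_{i=1}^{n}(z-z_i^{(j)})$, where $z_i^{(j)}\in S_j$ for all $j=1,\dots,k$ and $i=1,\dots,n$ (the points may depend on $n$). Then for every $\epsilon>\frac{3-\sqrt5}{2}$ there is a constant $c(k,\epsilon)$, independent of $n$ and of the choice of the points, such that for every $n\ge1$ and every $i\in\{1,\dots,k\}$ the number of zeros of $P_n'$ (counted with multiplicity) in $S_i^{\epsilon}$ is at least $n-c(k,\epsilon)$.
   Context: For a set $S\subset\mathbb{C}$ and $\epsilon>0$, $S^{\epsilon}=\{z\in\mathbb{C}:\operatorname{dist}(z,S)<\epsilon\}$ denotes the $\epsilon$-neighbourhood of $S$. *)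

(* Defs.v *)
From Stdlib Require Import Reals List ClassicalEpsilon.
Import ListNotations.
Open Scope R_scope.

Definition Cx : Type := (R * R)%type.
Definition C0 : Cx := (0, 0).
Definition C1 : Cx := (1, 0).
Definition RtoC (r : R) : Cx := (r, 0).
Definition Cadd (a b : Cx) : Cx := (fst a + fst b, snd a + snd b).
Definition Copp (a : Cx) : Cx := (- fst a, - snd a).
Definition Csub (a b : Cx) : Cx := Cadd a (Copp b).
Definition Cmul (a b : Cx) : Cx :=
  (fst a * fst b - snd a * snd b, fst a * snd b + snd a * fst b).
Definition Cscale (t : R) (a : Cx) : Cx := (t * fst a, t * snd a).
Definition Cnorm (a : Cx) : R := sqrt (fst a ^ 2 + snd a ^ 2).
Definition cdist (a b : Cx) : R := Cnorm (Csub a b).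

Definition Cconvex (S : Cx -> Prop) : Prop :=
  forall a b t, S a -> S b -> 0 <= t <= 1 ->
    S (Cadd (Cscale t a) (Cscale (1 - t) b)).
Definition Cbounded (S : Cx -> Prop) : Prop :=
  exists M, forall a, S a -> Cnorm a <= M.
Definition diam_le (S : Cx -> Prop) (d : R) : Prop :=
  forall a b, S a -> S b -> cdist a b <= d.
Definition dist_ge (S T : Cx -> Prop) (d : R) : Prop :=
  forall a b, S a -> T b -> d <= cdist a b.
Definition nbhd (S : Cx -> Prop) (eps : R) (z : Cx) : Prop :=
  exists s, S s /\ cdist z s < eps.

(** Polynomials over Cx as coefficient lists, lowest degree first *)
Definition poly : Type := list Cx.
Fixpoint peval (p : poly) (z : Cx) : Cx :=
  match p with nil => C0 | a :: q => Cadd a (Cmul z (peval q z)) end.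
Fixpoint padd (p q : poly) : poly :=
  match p, q with
  | nil, _ => q
  | _, nil => p
  | a :: p', b :: q' => Cadd a b :: padd p' q'
  end.
Definition pmul_lin (a : Cx) (p : poly) : poly :=
  padd (C0 :: p) (map (Cmul (Copp a)) p).
Definition poly_of_roots (l : list Cx) : poly := fold_right pmul_lin [C1] l.
Fixpoint pderiv_aux (i : nat) (p : poly) : poly :=
  match p with
  | nil => nil
  | a :: q => Cmul (RtoC (INR i)) a :: pderiv_aux (S i) q
  end.
Definition pderiv (p : poly) : poly :=
  match p with nil => nil | _ :: q => pderiv_aux 1 q end.

(* w is the list of zeros of p counted with multiplicity:
   p(z) = a * prod_{r in w} (z - r) with a <> 0 *)
Definition prod_lin (w : list Cx) (z : Cx) : Cx :=
  fold_right (fun r acc => Cmul (Csub z r) acc) C1 w.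
Definition roots_mult (p : poly) (w : list Cx) : Prop :=
  exists a, a <> C0 /\ forall z, peval p z = Cmul a (prod_lin w z).

Fixpoint cnt (P : Cx -> Prop) (l : list Cx) : nat :=
  match l with
  | nil => O
  | x :: l' => ((if excluded_middle_informative (P x) then 1 else 0) + cnt P l')%nat
  end.

Definition all_points (k n : nat) (z : nat -> nat -> Cx) : list Cx :=
  flat_map (fun j => map (z j) (seq 0 n)) (seq 0 k).

(* Main.v *)
(** Fix a cluster S and let P = P1 P2, where P1 has its zeros in S and P2 has
    the others. Up to constants P' = P1' P2 + P1 P2', which is joined to P1' P2
    by a segment of monic polynomials, each proportional to
    al P1' P2 + be P1 P2' with 0 <= be <= al. At a point z whose distance to S
    is about r, the logarithmic derivative P1'/P1 has modulus at least
    n r / (1 + r)^2, because its conjugate is the sum of the weights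
    1/|z - a|^2 times z minus a point of the convex set S, while P2'/P2 has
    modulus below n/5. For r > (3 - sqrt 5)/2 the first bound exceeds n/5, so no
    polynomial of the segment vanishes near the boundary of the
    r-neighbourhood. Zeros move continuously, hence their number there is the
    same for P' and for P1' P2, and by Gauss-Lucas it is at least n - 1: the
    constant c = 1 works. *)

Require Import Defs.
From Stdlib Require Import Reals List Lra.
From mathcomp Require all_boot all_order all_algebra archimedean complex.
From mathcomp Require ring lra Rstruct.
Open Scope R_scope.

(** The equation (1 + r)^2 = 5 r has the roots (3 - sqrt 5)/2 and (3 + sqrt 5)/2. The larger exceeds
    1, so capping [eps] at 1 keeps r strictly between them. *)
Lemma exists_cluster_radius (eps : R) : (3 - sqrt 5) / 2 < eps ->
  exists r : R, 0 < r /\ r <= 1 /\ r <= eps /\ (1 + r) * (1 + r) < 5 * r.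
Proof.
intros Heps.
assert (Hs : 0 <= sqrt 5) by apply sqrt_pos.
assert (Hs2 : sqrt 5 * sqrt 5 = 5) by (apply sqrt_sqrt; lra).
assert (Hs3 : 2 < sqrt 5 < 3) by nra.
exists (Rmin eps 1).
assert (Hr : (3 - sqrt 5) / 2 < Rmin eps 1) by (apply Rmin_glb_lt; lra).
assert (H1 := Rmin_r eps 1).
repeat split; [lra | exact H1 | apply Rmin_l | nra].
Qed.

Module RootClusters.
Import all_boot all_order all_algebra archimedean complex ring lra Rstruct.
Set Implicit Arguments.
Unset Strict Implicit.
Unset Printing Implicit Defensive.
Import Order.TTheory GRing.Theory Num.Theory.
Import Normc.
Local Open Scope ring_scope.
#[local] Arguments Normc.normc : simpl never.

(** * The modulus and coefficient bounds *)

Lemma normc_ge0 (R : rcfType) (x : R[i]) : 0 <= normc x.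
Proof. by case: x => a b; exact: sqrtr_ge0. Qed.

Lemma normcD_le (R : rcfType) (x y : R[i]) :
  normc (x + y) <= normc x + normc y.
Proof. exact: le_normcD. Qed.

Lemma normcB_le (R : rcfType) (x y : R[i]) :
  normc (x - y) <= normc x + normc y.
Proof. by apply: le_trans (normcD_le _ _) _; rewrite normcN. Qed.

Lemma normcBC (R : rcfType) (x y : R[i]) : normc (x - y) = normc (y - x).
Proof. by rewrite -opprB normcN. Qed.

Lemma normcR (R : rcfType) (t : R) : normc (t%:C)%C = `|t|.
Proof. by rewrite /normc /= expr0n /= addr0 sqrtr_sqr. Qed.

Lemma normc_one (R : rcfType) : normc (1 : R[i]) = 1.
Proof. exact: normc1. Qed.

Lemma normc_zero (R : rcfType) : normc (0 : R[i]) = 0.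
Proof. exact: normc0. Qed.

Lemma normcX (R : rcfType) (x : R[i]) n : normc (x ^+ n) = normc x ^+ n.
Proof.
elim: n => [|n IH]; first by rewrite !expr0 normc_one.
by rewrite !exprS normcM IH.
Qed.

Lemma normc_prod (R : rcfType) (s : seq R[i]) (f : R[i] -> R[i]) :
  normc (\prod_(x <- s) f x) = \prod_(x <- s) normc (f x).
Proof. exact: (big_morph _ (@normcM R) (@normc1 R)). Qed.

Lemma normc_sum_le (R : rcfType) (I : Type) (s : seq I) (f : I -> R[i]) :
  normc (\sum_(x <- s) f x) <= \sum_(x <- s) normc (f x).
Proof.
elim: s => [|a s IH]; first by rewrite !big_nil normc_zero.
by rewrite !big_cons; apply: le_trans (normcD_le _ _) _; rewrite lerD2l.
Qed.

(** A factor X - a shifts the coefficients and subtracts a times the old ones, so the bound grows by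
    a factor of at most 1 + M. *)
Lemma coef_prod_XsubC_le (R : rcfType) (M : R) (s : seq R[i]) :
  0 <= M -> {in s, forall x, normc x <= M} ->
  forall i, normc (\prod_(x <- s) ('X - x%:P))`_i <= (1 + M) ^+ size s.
Proof.
move=> M0; elim: s => [|a s IH] sM i.
  rewrite big_nil expr0 coefC; case: i => [|i] /=; first by rewrite normc_one.
  by rewrite normc_zero.
have aM : normc a <= M by apply: sM; rewrite inE eqxx.
have {}IH := IH (fun x xs => sM x (mem_behead (s := a :: s) xs)).
rewrite big_cons mulrBl coefB coefXM coefCM.
apply: le_trans (normcB_le _ _) _; rewrite normcM /= exprS mulrDl mul1r.
apply: lerD; first by case: eqP => _ //; rewrite normc_zero exprn_ge0 ?addr_ge0.
by apply: ler_pM; rewrite ?normc_ge0.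
Qed.

(** Synthetic division from the top: coefficient i of g is coefficient i + 1 of the product plus a
    times coefficient i + 1 of g. The induction variable m bounds how far i lies below [size g]. *)
Lemma coef_cofactor_XsubC_le (R : rcfType) (M c : R) (a : R[i])
    (g : {poly R[i]}) :
  0 <= M -> 0 <= c -> normc a <= M ->
  (forall i, normc (('X - a%:P) * g)`_i <= c) ->
  forall m i, (size g <= i + m)%N -> normc g`_i <= c * (1 + M) ^+ m.
Proof.
move=> M0 c0 aM gc; elim=> [|m IH] i gi.
  by rewrite nth_default ?normc_zero ?mulr_ge0 ?exprn_ge0 ?addr_ge0 // -(addn0 i).
have := gc i.+1; rewrite mulrBl coefB coefXM coefCM /= => h.
have h2 : normc g`_i <= c + M * (c * (1 + M) ^+ m).
  rewrite -[g`_i](subrK (a * g`_i.+1)); apply: le_trans (normcD_le _ _) _.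
  apply: lerD => //; rewrite normcM; apply: ler_pM; rewrite ?normc_ge0 //.
  by apply: IH; rewrite addSnnS.
apply: le_trans h2 _; rewrite exprS mulrDl mul1r mulrDr mulrCA lerD2r.
by rewrite ler_peMr // exprn_ege1 // lerDl.
Qed.

Lemma normc_horner_le (R : rcfType) (M c : R) (a : R[i]) (p : {poly R[i]}) :
  0 <= M -> 0 <= c -> normc a <= M -> (forall i, normc p`_i <= c) ->
  normc p.[a] <= c * (1 + M) ^+ size p.
Proof.
move=> M0 c0 aM; rewrite /horner; elim: (polyseq p) => [|b s IH] sc /=.
  by rewrite normc_zero expr0 mulr1.
apply: le_trans (normcD_le _ _) _; rewrite normcM exprS mulrDl mul1r mulrDr addrC.
apply: lerD; last first.
  rewrite mulrC mulrCA; apply: ler_pM; rewrite ?normc_ge0 //.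
  by apply: IH => i; exact: (sc i.+1).
apply: le_trans (sc 0%N) _.
by rewrite ler_peMr // exprn_ege1 // lerDl.
Qed.

Lemma horner_prod_XsubC (R : rcfType) (s : seq R[i]) (z : R[i]) :
  (\prod_(x <- s) ('X - x%:P)).[z] = \prod_(x <- s) (z - x).
Proof.
by rewrite horner_prod; apply: eq_bigr => x _; rewrite hornerXsubC.
Qed.

(** If every x were at distance at least b from z, the product would have modulus at least b to the
    number of factors. *)
Lemma exists_close_root (R : rcfType) (b : R) (z : R[i]) (s : seq R[i]) :
  0 < b -> normc (\prod_(x <- s) (z - x)) < b ^+ size s ->
  exists2 x, x \in s & normc (z - x) < b.
Proof.
move=> b0; rewrite normc_prod; elim: s => [|a s IH].
  by rewrite big_nil ltxx.
rewrite big_cons exprS => h.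
have [ab|ba] := ltP (normc (z - a)) b; first by exists a; rewrite ?inE ?eqxx.
case: IH => [|x xs xb]; last by exists x; rewrite // inE xs orbT.
rewrite -(ltr_pM2l b0); apply: le_lt_trans h.
by apply: ler_wpM2r => //; apply: prodr_ge0 => i _; exact: normc_ge0.
Qed.

(** * Continuity of roots *)

(* Roots are matched one at a time: a root of one polynomial makes the other
   one small there, hence is close to one of its roots; dividing both linear
   factors out keeps the coefficients close. *)
Lemma match_close_roots (R : rcfType) (M d : R) (n : nat) : 0 <= M -> 0 < d ->
  exists2 e : R, 0 < e & forall v w : seq R[i],
    size v = n -> size w = n ->
    {in v, forall x, normc x <= M} -> {in w, forall x, normc x <= M} ->
    (forall i, normc (\prod_(x <- v) ('X - x%:P)
                      - \prod_(x <- w) ('X - x%:P))`_i <= e) ->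
    exists2 w', perm_eq w w' & all2 (fun x y => normc (x - y) < d) v w'.
Proof.
move=> M0 d0; elim: n => [|n [e e0 IH]].
  by exists 1 => // -[|//] [|//] _ _ _ _ _; exists [::].
have K1 : 1 <= 1 + M by rewrite lerDl.
have K0 : 0 < 1 + M by apply: lt_le_trans K1.
set K := (1 + M) in K0 K1.
have KX m : 0 < K ^+ m by exact: exprn_gt0.
(* [L] amplifies the error |x - y| of a matched pair: [K ^+ n] bounds the coefficients of the
   cofactor [q1], and [K ^+ n.+2] is the loss in dividing by X - x. *)
pose L := K ^+ n * K ^+ n.+2.
have L0 : 0 < L by rewrite mulr_gt0.
pose b := Num.min d (e / L / 2).
have b0 : 0 < b by rewrite lt_min d0 !divr_gt0.
(* The first bound makes q smaller than [b ^+ n.+1] at the root x of p. The second leaves p - q at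
   most half of the error e allowed for the cofactors; [b * L] takes the other half. *)
pose e' := Num.min (b ^+ n.+1 / K ^+ n.+2 / 2) (e / K ^+ n.+2 / 2).
have e'0 : 0 < e' by rewrite lt_min !divr_gt0 ?exprn_gt0.
have bd : b <= d by rewrite ge_min lexx.
have be : b * L <= e / 2.
  apply: le_trans (_ : (e / L / 2) * L <= _).
    by rewrite ler_pM2r // ge_min lexx orbT.
  by rewrite mulrAC divfK ?gt_eqF.
have e'b : e' * K ^+ n.+2 < b ^+ n.+1.
  apply: le_lt_trans (_ : (b ^+ n.+1 / K ^+ n.+2 / 2) * K ^+ n.+2 < _).
    by rewrite ler_pM2r // ge_min lexx.
  rewrite mulrAC divfK ?gt_eqF // ltr_pdivrMr // ltr_pMr ?exprn_gt0 //; lra.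
have e'e : e' * K ^+ n.+2 <= e / 2.
  apply: le_trans (_ : (e / K ^+ n.+2 / 2) * K ^+ n.+2 <= _).
    by rewrite ler_pM2r // ge_min lexx orbT.
  by rewrite mulrAC divfK ?gt_eqF.
exists e' => // -[//|x v] w [sv] sw vM wM hc.
have xM : normc x <= M by apply: vM; rewrite inE eqxx.
set q := \prod_(x <- w) _ in hc.
set p := \prod_(x <- _) _ in hc.
have sp : size p = n.+2 by rewrite /p size_prod_XsubC /= sv.
have sq : size q = n.+2 by rewrite /q size_prod_XsubC sw.
have spq : (size (p - q)%R <= n.+2)%N.
  by rewrite (leq_trans (size_polyD _ _)) // size_polyN sp sq maxnn.
have [y yw xy] : exists2 y, y \in w & normc (x - y) < b.
  apply: exists_close_root => //; rewrite ?sw // -horner_prod_XsubC -/q.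
  have -> : q.[x] = - (p - q).[x].
    by rewrite hornerD hornerN /p big_cons hornerM hornerXsubC subrr mul0r add0r
               opprK.
  rewrite normcN; apply: le_lt_trans e'b.
  apply: le_trans (normc_horner_le M0 (ltW e'0) xM hc) _.
  by rewrite ler_pM2l // ler_weXn2l.
have pw := perm_to_rem yw; set w1 := rem y w in pw.
have sw1 : size w1 = n by rewrite /w1 size_rem // sw.
have w1M : {in w1, forall z, normc z <= M}.
  by move=> z zw; apply: wM; rewrite (perm_mem pw) inE zw orbT.
have vM1 : {in v, forall z, normc z <= M}.
  by move=> z zv; apply: vM; rewrite inE zv orbT.
set p1 := \prod_(x <- v) ('X - x%:P).
set q1 := \prod_(x <- w1) ('X - x%:P).
have eqp : p = ('X - x%:P) * p1 by rewrite /p big_cons.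
have eqq : q = ('X - y%:P) * q1 by rewrite /q (perm_big _ pw) big_cons.
have [w' pw' hw'] : exists2 w', perm_eq w1 w'
    & all2 (fun x y => normc (x - y) < d) v w'.
  apply: IH => // i; rewrite -/p1 -/q1.
  (* The removed factors X - x and X - y differ, which costs only the small term (x - y) q1. *)
  have eqh : ('X - x%:P) * (p1 - q1) = p - q + (x - y)%:P * q1.
    by rewrite eqp eqq polyCB; ring.
  have h1 j : normc (('X - x%:P) * (p1 - q1))`_j <= e' + b * K ^+ n.
    rewrite eqh coefD coefCM; apply: le_trans (normcD_le _ _) _.
    apply: lerD => //; rewrite normcM.
    apply: ler_pM; [exact: normc_ge0 | exact: normc_ge0 | exact: ltW |].
    by have := coef_prod_XsubC_le M0 w1M j; rewrite sw1.
  have c0 : 0 <= e' + b * K ^+ n by rewrite addr_ge0 ?mulr_ge0 ?ltW.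
  have := coef_cofactor_XsubC_le M0 c0 xM h1 (m := n.+2) (i := i).
  have sg : (size (p1 - q1)%R <= i + n.+2)%N.
    rewrite (leq_trans (size_polyD _ _)) // size_polyN !size_prod_XsubC sv sw1.
    by rewrite maxnn (leq_trans (leqnSn _)) // leq_addl.
  move=> /(_ sg) h2; apply: le_trans h2 _; rewrite mulrDl -mulrA -/K -/L; lra.
exists (y :: w'); first by rewrite (perm_trans pw) // perm_cons.
by rewrite /= hw' andbT (lt_le_trans xy).
Qed.

(** Cauchy's bound: if N = |x| > 1 + B, the lower terms sum to at most B (N^n - 1)/(N - 1) < N^n and
    cannot cancel the leading term. *)
Lemma monic_root_bound (R : rcfType) (p : {poly R[i]}) (x : R[i]) (B : R) :
  p \is monic -> (forall i, normc p`_i <= B) -> root p x -> normc x <= 1 + B.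
Proof.
move=> pm pB px; rewrite leNgt; apply/negP => hx.
have B0 : 0 <= B by apply: le_trans (normc_ge0 _) (pB 0%N).
have sp : size p = (size p).-1.+1 by rewrite prednK // size_poly_gt0 monic_neq0.
move: px; rewrite /root horner_coef sp big_ord_recr /= -lead_coefE (monicP pm) mul1r.
rewrite addrC addr_eq0 => /eqP /(congr1 (@normc R)); rewrite normcN normcX.
set n := (size p).-1; set N := normc x in hx * => h.
have : N ^+ n <= B * \sum_(i < n) N ^+ i.
  rewrite h mulr_sumr; apply: le_trans (normc_sum_le _ _) _.
  by apply: ler_sum => i _; rewrite normcM normcX ler_wpM2r ?exprn_ge0 ?normc_ge0.
have N1 : 0 < N - 1 by lra.
rewrite -(ler_pM2l N1) mulrCA -subrX1 => h2.
have Nn : 0 < N ^+ n by rewrite exprn_gt0; lra.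
have : B * N ^+ n < (N - 1) * N ^+ n by rewrite ltr_pM2r //; lra.
by move: h2; rewrite mulrBr mulr1; lra.
Qed.

Lemma count_all2 (T : eqType) (r : rel T) (a : pred T) (v w : seq T) :
  all2 r v w -> {in v & w, forall x y, r x y -> a x = a y} ->
  count a v = count a w.
Proof.
elim: v w => [|x v IH] [|y w] //= /andP[rxy vw] h.
rewrite (h x y) ?inE ?eqxx // (IH w) // => x' y' xv yw.
by apply: h; rewrite inE ?xv ?yw orbT.
Qed.

(* The roots move continuously along the segment and never leave or enter U,
   since a root is in U as soon as it is close to a point of U. *)
Lemma count_roots_segment (R : archiRcfType) (p0 p1 : {poly R[i]}) (d : R)
    (U : pred R[i]) :
  0 < d -> p0 \is monic -> p1 \is monic -> size p0 = size p1 ->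
  (forall t x y, 0 <= t <= 1 -> root (p0 + (t%:C)%C *: (p1 - p0)) y ->
     normc (x - y) < d -> U x -> U y) ->
  forall v w, p0 = \prod_(x <- v) ('X - x%:P) ->
    p1 = \prod_(x <- w) ('X - x%:P) -> count U v = count U w.
Proof.
move=> d0 m0 m1 s01 stable.
pose p t := p0 + (t%:C)%C *: (p1 - p0).
have sp0 : size p0 = (size p0).-1.+1.
  by rewrite prednK // size_poly_gt0 monic_neq0.
set n := (size p0).-1 in sp0.
have lead0 : p0`_n = 1 by rewrite -(monicP m0) lead_coefE.
have lead1 : p1`_n = 1 by rewrite -(monicP m1) lead_coefE -s01.
have sp t : size (p t) = n.+1.
  apply/eqP; rewrite eqn_leq; apply/andP; split; last first.
    rewrite ltnNge; apply/negP => /leq_sizeP /(_ n (leqnn n)).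
    rewrite coefD coefZ coefB lead0 lead1 subrr mulr0 addr0.
    by move/eqP; rewrite oner_eq0.
  apply/leq_sizeP => j jn.
  by rewrite coefD coefZ coefB !nth_default ?subrr ?mulr0 ?addr0 // -?s01 sp0.
have mp t : p t \is monic.
  by rewrite monicE lead_coefE sp /= coefD coefZ coefB lead0 lead1 subrr mulr0 addr0.
(* Summing over both polynomials bounds the coefficients all along the segment and also those of p1
   - p0. *)
pose B := \sum_(i < n.+1) (normc p0`_i + normc p1`_i).
have B0 : 0 <= B by apply: sumr_ge0 => i _; rewrite addr_ge0 ?normc_ge0.
have cB i : normc p0`_i + normc p1`_i <= B.
  have [ni|ni] := leqP n.+1 i.
    by rewrite !nth_default ?normc_zero ?addr0 // -?s01 sp0.
  rewrite /B (bigD1 (Ordinal ni)) //= lerDl.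
  by apply: sumr_ge0 => j _; rewrite addr_ge0 ?normc_ge0.
have pB t i : 0 <= t <= 1 -> normc (p t)`_i <= B.
  move=> /andP[t0 t1]; apply: le_trans (cB i); rewrite coefD coefZ coefB.
  have -> : p0`_i + t%:C%C * (p1`_i - p0`_i)
          = (1 - t)%:C%C * p0`_i + t%:C%C * p1`_i by rewrite rmorphB; ring.
  apply: le_trans (normcD_le _ _) _; rewrite !normcM !normcR !ger0_norm //; last lra.
  have := normc_ge0 p0`_i; have := normc_ge0 p1`_i => h1 h2.
  by apply: lerD; rewrite ler_piMl //; lra.
have [e e0 match_e] := match_close_roots n (addr_ge0 ler01 B0) d0.
(* For parameters this close the roots match within d, and [stable], used in both directions, gives
   matched roots the same membership in U. *)
have step s t v w : 0 <= s <= 1 -> 0 <= t <= 1 -> `|s - t| * B <= e ->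
    p s = \prod_(x <- v) ('X - x%:P) -> p t = \prod_(x <- w) ('X - x%:P) ->
    count U v = count U w.
  move=> s1 t1 ste ev ew.
  have sv : size v = n by move: (sp s); rewrite ev size_prod_XsubC => -[].
  have sw : size w = n by move: (sp t); rewrite ew size_prod_XsubC => -[].
  have rv x : x \in v -> root (p s) x by rewrite ev root_prod_XsubC.
  have rw x : x \in w -> root (p t) x by rewrite ew root_prod_XsubC.
  have vM : {in v, forall x, normc x <= 1 + B}.
    by move=> x /rv; apply: (monic_root_bound (mp s)) => i; exact: pB.
  have wM : {in w, forall x, normc x <= 1 + B}.
    by move=> x /rw; apply: (monic_root_bound (mp t)) => i; exact: pB.
  have [|w' ww' vw'] := match_e v w sv sw vM wM.
    move=> i; rewrite -ev -ew; apply: le_trans ste.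
    have -> : p s - p t = (s - t)%:C%C *: (p1 - p0).
      by rewrite /p rmorphB scalerBl opprD addrACA subrr add0r.
    rewrite coefZ normcM normcR coefB ler_wpM2l //.
    by apply: le_trans (normcB_le _ _) _; rewrite addrC.
  rewrite (permP ww'); apply: count_all2 vw' _ => x y xv yw xy.
  have yw' : y \in w by rewrite (perm_mem ww').
  have yx : normc (y - x) < d by rewrite normcBC.
  apply/idP/idP; first exact: (stable t x y t1 (rw y yw') xy).
  exact: (stable s y x s1 (rv x xv) yx).
(* Each of N equal steps of [0, 1] moves the coefficients by at most B / N <= e. *)
pose N := (Num.bound (B / e)).+1.
have NB : B <= e * N%:R.
  rewrite mulrC -ler_pdivrMr //; apply: ltW.
  apply: lt_le_trans (archi_boundP _) _; first by rewrite divr_ge0 // ltW.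
  by rewrite ler_nat.
have N0 : 0 < N%:R :> R by rewrite ltr0n.
have main j : (j <= N)%N -> forall v w, p0 = \prod_(x <- v) ('X - x%:P) ->
    p (j%:R / N%:R) = \prod_(x <- w) ('X - x%:P) -> count U v = count U w.
  elim: j => [|j IH] jN v w ev ew.
    apply: (step 0 0) => //; rewrite ?lexx ?ler01 ?subrr ?normr0 ?mul0r ?ltW //.
      by rewrite /p scale0r addr0.
    by rewrite -ew mul0r.
  have [u] := closed_field_poly_normal (p (j%:R / N%:R)).
  rewrite (monicP (mp _)) scale1r => eu.
  rewrite (IH (ltnW jN) v u ev eu).
  apply: (step _ _ _ _ _ _ _ eu ew).
  - by rewrite divr_ge0 //= ler_pdivrMr // mul1r ler_nat ltnW.
  - by rewrite divr_ge0 //= ler_pdivrMr // mul1r ler_nat.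
  rewrite distrC -mulrBl -natrB // subSnn mul1r ger0_norm ?invr_ge0 //.
  by rewrite mulrC ler_pdivrMr.
move=> v w ev ew; apply: (main N (leqnn N) v w ev).
by rewrite divff ?gt_eqF // /p scale1r addrC subrK.
Qed.

(** * Logarithmic derivatives and critical points *)

Definition convex_pred (R : rcfType) (S : R[i] -> Prop) : Prop :=
  forall (a b : R[i]) (t : R), 0 <= t <= 1 -> S a -> S b ->
    S ((t%:C)%C * a + ((1 - t)%:C)%C * b).

(** The barycentre c of the tail, of total weight L, is merged with the head a in the ratio L to f
    a. *)
Lemma convex_barycenter (R : rcfType) (S : R[i] -> Prop) (f : R[i] -> R)
    (s : seq R[i]) :
  convex_pred S -> (0 < size s)%N -> (forall x, x \in s -> S x /\ 0 < f x) ->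
  exists2 c, S c & \sum_(x <- s) ((f x)%:C)%C * x = ((\sum_(x <- s) f x)%:C)%C * c.
Proof.
move=> Sconv; case: s => // a s _; elim: s a => [|b s IH] a h.
  exists a; first by case: (h a); rewrite ?inE.
  by rewrite !big_seq1.
have [|c Sc ec] := IH b; first by move=> x xs; apply: h; rewrite inE xs orbT.
set t := b :: s in h ec *; rewrite !(big_cons _ _ a t) ec.
have [Sa fa] : S a /\ 0 < f a by apply: h; rewrite inE eqxx.
set L := \sum_(x <- t) f x.
have L0 : 0 <= L.
  by rewrite /L big_seq; apply: sumr_ge0 => x xt; rewrite ltW // (proj2 (h x _)) // inE xt orbT.
have aL : 0 < f a + L by lra.
exists ((f a / (f a + L))%:C%C * a + (1 - f a / (f a + L))%:C%C * c).
  apply: Sconv => //; rewrite divr_ge0 ?(ltW fa) ?(ltW aL) //=.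
  by rewrite ler_pdivrMr // mul1r lerDl.
rewrite mulrDr !mulrA -!rmorphM /= mulrBr mulr1 mulrC.
by rewrite [(f a + L) * _]mulrC divfK ?gt_eqF // [_ + L - _]addrAC subrr add0r mulrC.
Qed.

Lemma normc_conj (R : rcfType) (x : R[i]) : normc (conjc x) = normc x.
Proof. by case: x => a b; rewrite /normc /= sqrrN. Qed.

Lemma invc_conj (R : rcfType) (x : R[i]) :
  x^-1 = (((normc x)^-2)%:C)%C * conjc x.
Proof.
have [->|x0] := eqVneq x 0; first by rewrite invr0 rmorph0 mulr0.
have h : x * conjc x = ((normc x ^+ 2)%:C)%C by rewrite -sqr_normc rmorphXn.
have n0 : normc x != 0 by apply: contra x0 => /eqP/eq0_normc ->.
apply: (mulfI x0); rewrite divff // mulrCA h -rmorphM /= mulVf ?expf_neq0 //.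
Qed.

Lemma conj_invc (R : rcfType) (x : R[i]) :
  conjc x^-1 = (((normc x)^-2)%:C)%C * x.
Proof. by rewrite conjc_inv invc_conj normc_conj conjcK. Qed.

(* The conjugate of the sum of the 1/(z - a) is a positive combination of the
   z - a: this is the barycentric argument of Gauss and Lucas. *)
Lemma normc_sum_inv (R : rcfType) (S : R[i] -> Prop) (s : seq R[i]) (z : R[i]) :
  convex_pred S -> (0 < size s)%N -> {in s, forall a, S a} -> z \notin s ->
  exists2 c, S c &
    normc (\sum_(a <- s) (z - a)^-1)
      = (\sum_(a <- s) (normc (z - a))^-2) * normc (z - c).
Proof.
move=> Sconv s0 sS zs.
have pos a : a \in s -> 0 < (normc (z - a))^-2.
  move=> as_; rewrite invr_gt0 exprn_gt0 // lt_def normc_ge0 andbT.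
  apply/negP => /eqP/eq0_normc/eqP; rewrite subr_eq0 => /eqP za.
  by rewrite za as_ in zs.
have [c Sc ec] := convex_barycenter (f := fun a => (normc (z - a))^-2) Sconv s0
  (fun a as_ => conj (sS a as_) (pos a as_)).
exists c => //; rewrite -normc_conj rmorph_sum /=.
have -> : \sum_(a <- s) conjc (z - a)^-1
        = (\sum_(a <- s) (normc (z - a))^-2)%:C%C * (z - c).
  rewrite mulrBr -ec rmorph_sum /= mulr_suml -sumrB; apply: eq_bigr => a _.
  by rewrite conj_invc mulrBr.
rewrite normcM normcR ger0_norm //.
by rewrite big_seq; apply: sumr_ge0 => a /pos/ltW.
Qed.

Lemma deriv_prod_XsubC_horner (F : fieldType) (s : seq F) (z : F) : z \notin s ->
  (\prod_(a <- s) ('X - a%:P))^`().[z]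
    = (\prod_(a <- s) ('X - a%:P)).[z] * \sum_(a <- s) (z - a)^-1.
Proof.
elim: s => [|a s IH]; first by rewrite !big_nil derivC horner0 mulr0.
rewrite inE negb_or => /andP[za /IH e]; rewrite !big_cons.
rewrite derivM derivXsubC hornerD !hornerM hornerC hornerXsubC e.
set p := _.[z]; set t := \sum_(_ <- s) _.
by field; rewrite subr_eq0.
Qed.

(** Gauss-Lucas. Off the zeros the logarithmic derivative must vanish; its modulus is a positive
    weight times |z - c| with c in S, hence z = c. *)
Lemma critical_point_in_convex (R : rcfType) (S : R[i] -> Prop) (s : seq R[i])
    (z : R[i]) :
  convex_pred S -> (0 < size s)%N -> {in s, forall a, S a} ->
  root (\prod_(a <- s) ('X - a%:P))^`() z -> S z.
Proof.
move=> Sconv s0 sS; have [/sS //|zs] := boolP (z \in s).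
rewrite /root deriv_prod_XsubC_horner // mulf_eq0 -/(root _ z) root_prod_XsubC.
rewrite (negPf zs) /= => /eqP e.
have [c Sc] := normc_sum_inv Sconv s0 sS zs; rewrite e normc_zero => /esym/eqP.
rewrite mulf_eq0 => /orP[|/eqP/eq0_normc/eqP]; last first.
  by rewrite subr_eq0 => /eqP ->.
case: s s0 {sS e} zs => // a s _; rewrite inE negb_or => /andP[za _].
have na : 0 < (normc (z - a))^-2.
  rewrite invr_gt0 exprn_gt0 // lt_def normc_ge0 andbT.
  by apply: contra za => /eqP/eq0_normc/eqP; rewrite subr_eq0.
have h : 0 <= \sum_(x <- s) (normc (z - x))^-2.
  by apply: sumr_ge0 => x _; rewrite invr_ge0 exprn_ge0 ?normc_ge0.
by rewrite big_cons => /eqP; lra.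
Qed.

Lemma ler_sum_const (R : realFieldType) (T : eqType) (s : seq T) (f : T -> R)
    (c : R) : {in s, forall x, f x <= c} -> \sum_(x <- s) f x <= (size s)%:R * c.
Proof.
move=> h; rewrite big_seq; apply: le_trans (_ : \sum_(x <- s | x \in s) c <= _).
  exact: ler_sum.
by rewrite -big_seq big_const_seq count_predT iter_addr_0 mulr_natl.
Qed.

Lemma ger_sum_const (R : realFieldType) (T : eqType) (s : seq T) (f : T -> R)
    (c : R) : {in s, forall x, c <= f x} -> (size s)%:R * c <= \sum_(x <- s) f x.
Proof.
move=> h; rewrite -lerN2 -mulrN -sumrN; apply: ler_sum_const => x xs.
by rewrite lerN2 h.
Qed.

(* On the annulus the zeros in l1 contribute at least n/5 to the logarithmic
   derivative, because r/(1+r')^2 = 1/5, and those in l2 less than n/5. *)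
Lemma annulus_nonvanishing (R : rcfType) (k n : nat) (S : R[i] -> Prop)
    (l1 l2 : seq R[i]) (r r' al be : R) (z s0 : R[i]) :
  convex_pred S -> (0 < n)%N -> size l1 = n -> size l2 = (n * k)%N ->
  {in l1, forall a, S a} ->
  (forall a b, S a -> S b -> normc (a - b) <= 1) ->
  (forall a b, S a -> b \in l2 -> 5 * k.+1%:R <= normc (a - b)) ->
  0 < r -> r' < 5 -> (1 + r') ^+ 2 = 5 * r ->
  S s0 -> normc (z - s0) < r' -> (forall s, S s -> r <= normc (z - s)) ->
  0 < al -> 0 <= be <= al ->
  let P1 := \prod_(a <- l1) ('X - a%:P) in
  let P2 := \prod_(a <- l2) ('X - a%:P) in
  ~~ root ((al%:C)%C *: (P1^`() * P2) + (be%:C)%C *: (P1 * P2^`())) z.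
Proof.
move=> Sconv n0 sl1 sl2 l1S diam far r0 r5 rr' Ss0 zs0 zS al0.
move=> /andP[be0 beal]; set P1 := \prod_(a <- l1) _; set P2 := \prod_(a <- l2) _; rewrite /=.
have l1S_pos : (0 < size l1)%N by rewrite sl1.
have z1 : z \notin l1.
  by apply/negP => /l1S /zS; rewrite subrr normc_zero leNgt r0.
have k1 : 1 <= k.+1%:R :> R by rewrite ler1n.
have zfar b : b \in l2 -> 5 * k.+1%:R - r' <= normc (z - b).
  move=> bl; have := far _ _ Ss0 bl; have := normcD_le (s0 - z) (z - b).
  by rewrite addrA subrK (normcBC s0 z); lra.
have z2 : z \notin l2.
  by apply/negP => /zfar; rewrite subrr normc_zero; lra.
have P1z : P1.[z] != 0 by rewrite -/(root P1 z) root_prod_XsubC.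
have P2z : P2.[z] != 0 by rewrite -/(root P2 z) root_prod_XsubC.
apply/negP; rewrite /root hornerD !hornerZ !hornerM !deriv_prod_XsubC_horner // -/P1 -/P2.
set A := \sum_(a <- l1) _; set B := \sum_(a <- l2) _.
have -> : al%:C%C * (P1.[z] * A * P2.[z]) + be%:C%C * (P1.[z] * (P2.[z] * B))
   = P1.[z] * P2.[z] * (al%:C%C * A + be%:C%C * B) by ring.
rewrite mulf_eq0 mulf_eq0 (negPf P1z) (negPf P2z) /= addr_eq0 => /eqP.
move/(congr1 (@normc R)); rewrite normcN !normcM !normcR !ger0_norm ?(ltW al0) //.
have nR : 0 < n%:R :> R by rewrite ltr0n.
(* The n k zeros in [l2] are at distance at least 5 (k + 1) - r' from z, which exceeds 5 k because
   r' < 5. *)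
have hB : normc B < n%:R / 5.
  apply: le_lt_trans (normc_sum_le _ _) _.
  apply: (@le_lt_trans _ _ ((n * k)%:R * (5 * k.+1%:R - r')^-1)).
    rewrite -sl2; apply: ler_sum_const => b bl; rewrite normcV lef_pV2 ?posrE.
    - exact: zfar.
    - by have := zfar _ bl; lra.
    - lra.
  rewrite natrM -mulrA ltr_pM2l // ltr_pdivrMr; last lra.
  by rewrite -[k.+1]addn1 natrD; lra.
(* Each weight is at least 1/(1 + r')^2 = 1/(5 r), and the point c of S is at distance at least r
   from z: together n r/(5 r). *)
have hA : n%:R / 5 <= normc A.
  have [c Sc ->] := normc_sum_inv Sconv l1S_pos l1S z1.
  have h : n%:R * (5 * r)^-1 <= \sum_(a <- l1) (normc (z - a))^-2.
    rewrite -sl1; apply: ger_sum_const => a al1; rewrite -rr'.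
    have za : normc (z - a) <= 1 + r'.
      have := diam _ _ Ss0 (l1S _ al1); have := normcD_le (z - s0) (s0 - a).
      by rewrite addrA subrK; lra.
    have za0 : 0 < normc (z - a) by have := zS _ (l1S _ al1); lra.
    rewrite lef_pV2 ?posrE ?exprn_gt0 //; last lra.
    by rewrite ler_pXn2r ?nnegrE //; lra.
  have {h} := ler_pM _ (ltW r0) h (zS _ Sc).
  rewrite mulr_ge0 ?invr_ge0 ?mulr_ge0 ?(ltW nR) ?(ltW r0) // => /(_ isT).
  by apply: le_trans; rewrite invfM mulrA divfK ?gt_eqF.
have : be * normc B <= al * normc B by rewrite ler_wpM2r ?normc_ge0.
have : al * normc B < al * normc A by rewrite ltr_pM2l //; lra.
lra.
Qed.

(** * Counting critical points in one cluster *)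

Lemma monic_deriv (F : numFieldType) (p : {poly F}) (n : nat) :
  p \is monic -> size p = n.+2 ->
  (n.+1%:R)^-1 *: p^`() \is monic /\ size ((n.+1%:R)^-1 *: p^`()) = n.+1.
Proof.
move=> pm sp; have n0 : (n.+1%:R)^-1 != 0 :> F by rewrite invr_eq0 pnatr_eq0.
have sd : size p^`() = n.+1.
  apply/eqP; rewrite eqn_leq -ltnS -sp lt_size_deriv ?monic_neq0 //=.
  rewrite ltnNge; apply/negP => /leq_sizeP /(_ n (leqnn n)) /eqP.
  have := monicP pm; rewrite lead_coefE sp /= coef_deriv => ->.
  by rewrite pnatr_eq0.
split; last by rewrite size_scale.
have := monicP pm; rewrite lead_coefE sp /= => e.
by rewrite monicE lead_coefZ lead_coefE sd /= coef_deriv e mulVf // pnatr_eq0.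
Qed.

(** Here k is the number of other clusters, whose zeros form [l2], and each cluster has n + 1 zeros.
    The n zeros found in U come from the n critical points of P1, which lie in S. *)
Theorem cluster_critical_points (R : archiRcfType) (k n : nat)
    (S : R[i] -> Prop) (l1 l2 : seq R[i]) (r : R) (U : pred R[i]) :
  convex_pred S -> size l1 = n.+1 -> size l2 = (n.+1 * k)%N ->
  {in l1, forall a, S a} ->
  (forall a b, S a -> S b -> normc (a - b) <= 1) ->
  (forall a b, S a -> b \in l2 -> 5 * k.+1%:R <= normc (a - b)) ->
  0 < r <= 1 -> (1 + r) ^+ 2 < 5 * r ->
  (forall z, reflect (exists2 s, S s & normc (z - s) < r) (U z)) ->
  forall (w : seq R[i]) (c : R[i]), c != 0 ->
    (\prod_(a <- l1 ++ l2) ('X - a%:P))^`() = c *: \prod_(x <- w) ('X - x%:P) ->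
  (n <= count U w)%N.
Proof.
move=> Sconv sl1 sl2 l1S diam far /andP[r0 r1] rr UP w c c0.
rewrite big_cat /=; set P1 := \prod_(a <- l1) _; set P2 := \prod_(a <- l2) _.
move=> ew.
have [P1m P2m] : P1 \is monic /\ P2 \is monic by split; apply: monic_prod_XsubC.
have sP1 : size P1 = n.+2 by rewrite size_prod_XsubC sl1.
have sP2 : size P2 = (n.+1 * k).+1 by rewrite size_prod_XsubC sl2.
have [P1'm sP1'] := monic_deriv P1m sP1.
have sP : size (P1 * P2) = (n + n.+1 * k).+2.
  by rewrite size_monicM ?monic_neq0 // sP1 sP2 addnS.
have P12m : P1 * P2 \is monic by rewrite monicMr.
have [p1m sp1] := monic_deriv P12m sP.
set p1 := (_ *: (P1 * P2)^`()) in p1m sp1.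
have p1w : p1 = \prod_(x <- w) ('X - x%:P).
  move: p1m; rewrite /p1 ew scalerA monicE lead_coefZ.
  by rewrite (monicP (monic_prod_XsubC _ _ _)) mulr1 => /eqP ->; rewrite scale1r.
set Q1 := (_ *: P1^`()) in P1'm sP1'.
pose p0 := Q1 * P2.
have p0m : p0 \is monic by rewrite monicMr.
have sp0 : size p0 = size p1.
  by rewrite sp1 size_monicM ?monic_neq0 // sP1' sP2 addnS.
have [u] := closed_field_poly_normal Q1.
rewrite (monicP P1'm) scale1r => eu.
have su : size u = n by move: sP1'; rewrite eu size_prod_XsubC => -[].
have p0u : p0 = \prod_(x <- u ++ l2) ('X - x%:P) by rewrite big_cat /= -eu.
(* The outer radius solves (1 + r')^2 = 5 r. It exceeds r because (1 + r)^2 < 5 r, and r' - r is the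
   width of the root-free annulus. *)
pose r' := Num.sqrt (5 * r) - 1.
have r5 : 0 <= 5 * r by lra.
have rr' : (1 + r') ^+ 2 = 5 * r by rewrite /r' addrC subrK sqr_sqrtr.
have r'5 : r' < 5.
  rewrite /r' ltrBlDr -(@ltr_pXn2r _ 2) ?nnegrE ?sqrtr_ge0 ?sqr_sqrtr //; lra.
have rltr' : r < r'.
  rewrite /r' ltrBrDr addrC -(@ltr_pXn2r _ 2) ?nnegrE ?sqrtr_ge0 ?sqr_sqrtr //; lra.
have d0 : 0 < r' - r by lra.
(* A root y outside U but within r' - r of a point of U would lie in the annulus. *)
have stable t x y : 0 <= t <= 1 -> root (p0 + (t%:C)%C *: (p1 - p0)) y ->
    normc (x - y) < r' - r -> U x -> U y.
  move=> /andP[t0 t1] py xy /UP[s Ss xs]; apply/idP; apply/negPn/negP => nU.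
  have ys : normc (y - s) < r'.
    have := normcD_le (y - x) (x - s); rewrite addrA subrK (normcBC y x); lra.
  have ySr a : S a -> r <= normc (y - a).
    by move=> Sa; rewrite leNgt; apply: contra nU => ya; apply/UP; exists a.
  (* The degree of P1 P2 is (n + 1)(k + 1) = n + (n + 1) k + 1. By the product rule, P1' P2 receives
     (1 - t)/(n + 1) from p0 and [be] from p1, while P1 P2' receives [be] alone. *)
  pose be := t / (n + n.+1 * k).+1%:R; pose al := (1 - t) / n.+1%:R + be.
  have be0 : 0 <= be by rewrite divr_ge0.
  have al0 : 0 < al.
    have [t_lt|t_ge] := ltP t 1.
      by rewrite ltr_wpDr // divr_gt0 ?subr_gt0.
    by rewrite ltr_wpDl ?divr_ge0 ?subr_ge0 // divr_gt0 //; lra.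
  have beal : 0 <= be <= al by rewrite be0 /al lerDr divr_ge0 ?subr_ge0.
  have := annulus_nonvanishing Sconv (ltn0Sn n) sl1 sl2 l1S diam far r0 r'5 rr' Ss ys ySr
    al0 beal.
  rewrite -/P1 -/P2 /=; suff <- : p0 + t%:C%C *: (p1 - p0)
      = al%:C%C *: (P1^`() * P2) + be%:C%C *: (P1 * P2^`()) by rewrite py.
  have natV m : (m.+1%:R : R[i])^-1 = ((m.+1%:R)^-1)%:C%C.
    by rewrite fmorphV rmorph_nat.
  rewrite /p0 /p1 /Q1 !natV /al /be derivM -!mul_polyC; ring.
rewrite -(count_roots_segment d0 p0m p1m sp0 stable p0u p1w).
suff allU : all U u.
  by rewrite count_cat; move: allU; rewrite all_count => /eqP ->; rewrite su leq_addr.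
apply/allP => x xu; apply/UP; exists x; last by rewrite subrr normc_zero.
apply: (critical_point_in_convex Sconv (s := l1)) => //; first by rewrite sl1.
have : root Q1 x by rewrite eu root_prod_XsubC.
by rewrite /Q1 rootZ // invr_eq0 pnatr_eq0.
Qed.

(** * Transfer to pairs of reals *)

Definition toC (a : Cx) : Rdefinitions.R[i] := Complex a.1 a.2.
Definition ofC (a : Rdefinitions.R[i]) : Cx := (complex.Re a, complex.Im a).

Lemma toCK : cancel toC ofC. Proof. by case. Qed.

Lemma ofCK : cancel ofC toC. Proof. by case. Qed.

Lemma toCD a b : toC (Cadd a b) = toC a + toC b.
Proof. by []. Qed.

Lemma toCN a : toC (Copp a) = - toC a.
Proof. by []. Qed.

Lemma toCM a b : toC (Cmul a b) = toC a * toC b.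
Proof. by []. Qed.

Lemma toC0 : toC Defs.C0 = 0. Proof. by []. Qed.

Lemma toC1 : toC Defs.C1 = 1. Proof. by []. Qed.

Lemma toC_nat n : toC (RtoC (INR n)) = n%:R.
Proof. by rewrite /toC /= INRE -[LHS]/((n%:R)%:C)%C rmorph_nat. Qed.

Lemma toC_norm a : Cnorm a = normc (toC a).
Proof. by rewrite /Cnorm RsqrtE !RpowE; case: a. Qed.

Lemma toC_dist a b : cdist a b = normc (toC a - toC b).
Proof. by rewrite /cdist toC_norm. Qed.

Lemma toC_scale t a : toC (Cscale t a) = (t%:C)%C * toC a.
Proof. by case: a => x y; rewrite /toC /=; simpc. Qed.

(** [Poly] strips the trailing zeros that a coefficient list may carry. *)
Definition toP (p : Defs.poly) : {poly Rdefinitions.R[i]} := Poly (map toC p).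

Lemma toP_cons a (p : Defs.poly) : toP (a :: p) = (toC a)%:P + 'X * toP p.
Proof. by rewrite /toP /= cons_poly_def addrC mulrC. Qed.

Lemma toP_horner p z : toC (peval p z) = (toP p).[toC z].
Proof.
elim: p => [|a p IH]; first by rewrite /toP horner0.
by rewrite toP_cons hornerD hornerM hornerC hornerX -IH.
Qed.

Lemma toP_add p q : toP (padd p q) = toP p + toP q.
Proof.
elim: p q => [|a p IH] [|b q]; rewrite ?add0r ?addr0 //.
by rewrite [padd _ _]/= !toP_cons IH toCD polyCD; ring.
Qed.

Lemma toP_scale c p : toP (List.map (Cmul c) p) = toC c *: toP p.
Proof.
elim: p => [|a p IH]; first by rewrite /toP /= scaler0.
by rewrite [List.map _ _]/= !toP_cons IH toCM polyCM -!mul_polyC; ring.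
Qed.

Lemma toP_mul_lin a p : toP (pmul_lin a p) = ('X - (toC a)%:P) * toP p.
Proof.
by rewrite /pmul_lin toP_add toP_scale toP_cons toC0 toCN -mul_polyC polyCN; ring.
Qed.

Lemma toP_poly_of_roots (l : seq Cx) :
  toP (poly_of_roots l) = \prod_(x <- map toC l) ('X - x%:P).
Proof.
elim: l => [|a l IH]; last by rewrite [map _ _]/= big_cons -IH -toP_mul_lin.
by rewrite big_nil /poly_of_roots /= toP_cons toC1 /toP /= mulr0 addr0.
Qed.

Lemma coef_toP_deriv_aux i p j : (toP (pderiv_aux i p))`_j = (toP p)`_j *+ (i + j).
Proof.
rewrite /toP !coef_Poly; elim: p i j => [|a p IH] i [|j] /=; rewrite ?mul0rn //.
  by rewrite toCM toC_nat addn0 mulr_natl.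
by rewrite IH addSnnS.
Qed.

Lemma toP_deriv p : toP (pderiv p) = (toP p)^`().
Proof.
case: p => [|a p]; first by rewrite /toP deriv0.
apply/polyP => j; rewrite coef_deriv coef_toP_deriv_aux add1n.
by rewrite /toP !coef_Poly.
Qed.

Lemma toC_prod_lin w z : toC (prod_lin w z) = \prod_(x <- map toC w) (toC z - x).
Proof.
by elim: w => [|a w IH]; rewrite ?big_nil // [map _ _]/= big_cons -IH.
Qed.

(** The difference vanishes at as many distinct natural numbers as its size, which is more than its
    degree allows unless it is zero. *)
Lemma horner_inj (F : numDomainType) (p q : {poly F}) :
  (forall z, p.[z] = q.[z]) -> p = q.
Proof.
move=> h; apply/eqP; rewrite -subr_eq0; apply/eqP.
apply: (@roots_geq_poly_eq0 _ _ [seq i%:R | i <- iota 0 (size (p - q)%R)]).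
- by apply/allP => x _; rewrite /root hornerD hornerN h subrr.
- by rewrite map_inj_uniq ?iota_uniq // => i j /eqP; rewrite eqr_nat => /eqP.
by rewrite size_map size_iota.
Qed.

(** [roots_mult] equates values at all points; this upgrades it to a factorization of
    polynomials. *)
Lemma roots_mult_toP (p : Defs.poly) (w : seq Cx) : roots_mult p w ->
  exists2 c, c != 0 & toP p = c *: \prod_(x <- map toC w) ('X - x%:P).
Proof.
case=> a [a0 pw]; exists (toC a).
  by apply/eqP => e; apply: a0; rewrite -(toCK a) e.
apply: horner_inj => z; rewrite -(ofCK z) -toP_horner pw toCM toC_prod_lin.
by rewrite hornerZ horner_prod_XsubC.
Qed.

Lemma count_le_cnt (U : pred Rdefinitions.R[i]) (P : Cx -> Prop) (w : seq Cx) :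
  (forall x, U (toC x) -> P x) -> (count U (map toC w) <= cnt P w)%N.
Proof.
move=> UP; elim: w => //= x w IH; apply: leq_add; last exact: IH.
case: ClassicalEpsilon.excluded_middle_informative => [_|nP]; first exact: leq_b1.
by case: (boolP (U _)) => // /UP.
Qed.

Lemma map_toC_all_points k n (z : nat -> nat -> Cx) :
  map toC (all_points k n z) = [seq toC (z j i) | j <- iota 0 k, i <- iota 0 n].
Proof.
have eq_iota m l : List.seq m l = iota m l by elim: l m => //= l IH m; rewrite IH.
rewrite /all_points !eq_iota; elim: (iota 0 k) => //= j s IH.
by rewrite map_cat IH -map_comp.
Qed.

(** Reordering puts the zeros of cluster i first, which gives the splitting P = P1 P2. *)
Lemma perm_all_points k n (z : nat -> nat -> Cx) i : (i < k)%N ->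
  exists2 l, perm_eq (map toC (all_points k n z))
                     ([seq toC (z i m) | m <- iota 0 n] ++ l)
    & size l = (n * k.-1)%N /\ forall b, b \in l ->
        exists j m, [/\ (j < k)%N, j <> i, (m < n)%N & b = toC (z j m)].
Proof.
move=> ik; pose s := rem i (iota 0 k).
have ki : i \in iota 0 k by rewrite mem_iota.
have ps := perm_to_rem ki.
exists [seq toC (z j m) | j <- s, m <- iota 0 n].
  rewrite map_toC_all_points -(allpairs_cons (fun j m => toC (z j m))).
  exact: perm_allpairs_dep.
split; first by rewrite size_allpairs size_rem // !size_iota mulnC.
move=> b /allpairsP[[j m] [/= js mn ->]]; exists j, m; split=> //.
- by move: (mem_rem js); rewrite mem_iota.
- by move=> ji; move: js; rewrite ji mem_rem_uniq ?iota_uniq // inE eqxx.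
by move: mn; rewrite mem_iota.
Qed.

Lemma IZR_5 : IZR 5 = 5%:R.
Proof. by rewrite -INRE INR_IZR_INZ. Qed.

Lemma cluster_count (k n : nat) (r eps : R) (S : nat -> Cx -> Prop)
    (z : nat -> nat -> Cx) (w : seq Cx) (i : nat) :
  Rlt R0 r -> Rle r R1 -> Rle r eps ->
  Rlt (Rmult (Rplus 1 r) (Rplus 1 r)) (Rmult (IZR 5) r) ->
  (forall j, (j < k.+1)%coq_nat -> Cconvex (S j) /\ diam_le (S j) R1) ->
  (forall j l, (j < k.+1)%coq_nat -> (l < k.+1)%coq_nat -> j <> l ->
     dist_ge (S j) (S l) (Rmult (IZR 5) (INR k.+1))) ->
  (forall j m, (j < k.+1)%coq_nat -> (m < n.+1)%coq_nat -> S j (z j m)) ->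
  roots_mult (pderiv (poly_of_roots (all_points k.+1 n.+1 z))) w ->
  (i < k.+1)%coq_nat -> (n <= cnt (nbhd (S i) eps) w)%coq_nat.
Proof.
move=> /RltP r0 /RleP r1 /RleP reps /RltP rr0 Sprop Sfar zS /roots_mult_toP[c c0].
rewrite toP_deriv toP_poly_of_roots => ew /ssrnat.ltP ik; apply/ssrnat.leP.
have [l2 pl [sl2 l2S]] := perm_all_points n.+1 z ik.
rewrite (perm_big _ pl) in ew.
have [Sconv Sdiam] := Sprop i (elimT ssrnat.ltP ik).
pose T x := S i (ofC x).
(* [count] takes a boolean predicate, so membership in the r-neighbourhood is decided by excluded
   middle. *)
pose U x : bool := if ClassicalEpsilon.excluded_middle_informative
  (exists2 s, T s & normc (x - s) < r) then true else false.
have UP x : reflect (exists2 s, T s & normc (x - s) < r) (U x).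
  by rewrite /U; case: ClassicalEpsilon.excluded_middle_informative => h; constructor.
(* Zeros are counted in the r-neighbourhood, which lies in the [eps]-neighbourhood since r <=
   eps. *)
apply: leq_trans (count_le_cnt (U := U) w _); last first.
  move=> x /UP[s Ts xs]; exists (ofC s); split=> //; apply/RltP.
  by rewrite toC_dist ofCK (lt_le_trans xs).
have rr : (1 + r) ^+ 2 < 5 * r by move: rr0; rewrite RmultE IZR_5 -expr2.
have r01 : 0 < r <= 1 by rewrite r0 r1.
apply: (cluster_critical_points (S := T) (k := k) _ _ sl2 _ _ _ r01 rr UP c0 ew).
- move=> a b t /andP[t0 t1] Ta Tb; rewrite /T.
  have -> : (t%:C)%C * a + ((1 - t)%:C)%C * b
      = toC (Cadd (Cscale t (ofC a)) (Cscale (Rminus (IZR 1) t) (ofC b))).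
    by rewrite toCD !toC_scale !ofCK.
  by rewrite toCK; apply: Sconv => //; split; apply/RleP.
- by rewrite size_map size_iota.
- move=> a /mapP[m]; rewrite mem_iota => /= /ssrnat.ltP mn ->; rewrite /T toCK.
  exact: zS (elimT ssrnat.ltP ik) mn.
- by move=> a b Ta Tb; have /RleP := Sdiam _ _ Ta Tb; rewrite toC_dist !ofCK.
move=> a b Ta /l2S[j [m [/ssrnat.ltP jk ji /ssrnat.ltP mn ->]]].
have /RleP := Sfar i j (elimT ssrnat.ltP ik) jk (not_eq_sym ji) _ _ Ta (zS j m jk mn).
by rewrite toC_dist ofCK RmultE IZR_5 INRE.
Qed.

End RootClusters.

Theorem mainTheorem1 :
  forall (k : nat), (1 <= k)%nat ->
  forall eps : R, (3 - sqrt 5) / 2 < eps ->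
  exists c : nat,
  forall S : nat -> Cx -> Prop,
    (forall j, (j < k)%nat -> Cconvex (S j) /\ Cbounded (S j) /\ diam_le (S j) 1) ->
    (forall i j, (i < k)%nat -> (j < k)%nat -> i <> j ->
        (forall a, S i a -> ~ S j a) /\ dist_ge (S i) (S j) (5 * INR k)) ->
  forall n : nat, (1 <= n)%nat ->
  forall z : nat -> nat -> Cx,
    (forall j i, (j < k)%nat -> (i < n)%nat -> S j (z j i)) ->
  forall w : list Cx,
    roots_mult (pderiv (poly_of_roots (all_points k n z))) w ->
  forall i, (i < k)%nat ->
    (n <= cnt (nbhd (S i) eps) w + c)%nat.
Proof.
intros k Hk eps Heps.
destruct (exists_cluster_radius eps Heps) as (r & Hr0 & Hr1 & Hre & Hrr).
(* The single lost zero is the drop in degree from P1 to P1'. *)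
exists 1%nat; intros S HS Hfar n Hn z Hz w Hw i Hi.
destruct k as [|k]; [inversion Hk |]; destruct n as [|n]; [inversion Hn |].
rewrite Nat.add_1_r; apply le_n_S.
apply (@RootClusters.cluster_count k n r eps S z w i); auto.
- intros j Hj; destruct (HS j Hj) as (? & _ & ?); auto.
- intros j l Hj Hl Hjl; apply (Hfar j l Hj Hl Hjl).
Qed.
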